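(* If $M$ is a totally umbilical Lagrangian submanifold of a Kaehler manifold, then either $\dim(M)=1$ or $M$ is totally geodesic.
   Context: An $n$-dimensional submanifold $M$ of an almost Hermitian manifold $(\widetilde M,J,g)$ is Lagrangian if $J(T_pM)=T_p^\perp M$ for every $p\in M$ (so $\widetilde M$ has real dimension $2n$); $\dim$ denotes real dimension. Let $\sigma$ be the second fundamental form of $M$ and $H=\frac1n\mathrm{trace}(\sigma)$ the mean curvature vector. $M$ is totally umbilical if $\sigma(X,Y)=g(X,Y)H$ for all $X,Y$ tangent to $M$ at every point, and totally geodesic if $\sigma=0$ at every point. *)

(* Defs.v *)
From mathcomp Require Import all_boot all_order all_algebra.
From mathcomp Require Import all_classical all_reals all_analysis.

Set Implicit Arguments.
Unset Strict Implicit.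
Unset Printing Implicit Defensive.
Import Order.TTheory GRing.Theory Num.Theory.
Import numFieldNormedType.Exports.

Local Open Scope classical_set_scope.
Local Open Scope ring_scope.

(** C^k and C^oo maps on an open set of R^n. *)

Fixpoint Ck_on (R : realType) (n : nat) (W : normedModType R) (k : nat)
    (U : set 'rV[R]_n) (f : 'rV[R]_n -> W) : Prop :=
  if k is k'.+1 then
    (forall x, U x -> differentiable f x) /\
    (forall v, Ck_on k' U (fun x => 'D_v f x))
  else forall x, U x -> {for x, continuous f}.

Definition smooth_on (R : realType) (n : nat) (W : normedModType R)
    (U : set 'rV[R]_n) (f : 'rV[R]_n -> W) : Prop :=
  forall k, Ck_on k U f.

(** Smooth manifolds (without boundary, Hausdorff, second countable). *)

(* [cmap] and [cpar] are total functions, meaningful only on [cdom] and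
   [cimg] respectively. *)
Record chart (R : realType) (n : nat) (M : topologicalType) := Chart {
  cdom : set M;
  cmap : M -> 'rV[R]_n;
  cpar : 'rV[R]_n -> M;
  cdom_open : open cdom;
  cimg_open : open (cmap @` cdom);
  cmapK : forall p, cdom p -> cpar (cmap p) = p;
  cmap_continuous : forall p, cdom p -> {for p, continuous cmap};
  cpar_continuous :
    forall x, (cmap @` cdom) x -> {for x, continuous cpar} }.

Definition cimg (R : realType) (n : nat) (M : topologicalType)
    (c : chart R n M) : set 'rV[R]_n := cmap c @` cdom c.

Definition transition (R : realType) (n : nat) (M : topologicalType)
    (c c' : chart R n M) : 'rV[R]_n -> 'rV[R]_n := cmap c' \o cpar c.

Record manifold (R : realType) (n : nat) := Manifold {
  mcarrier :> topologicalType;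
  atlas : set (chart R n mcarrier);
  atlas_hausdorff : hausdorff_space mcarrier;
  atlas_second_countable : @second_countable mcarrier;
  atlas_cover : forall p : mcarrier, exists2 c, atlas c & cdom c p;
  atlas_compatible : forall c c', atlas c -> atlas c' ->
    smooth_on (cmap c @` (cdom c `&` cdom c')) (transition c c') }.

(** Tensor fields are given by their components in the charts of the atlas,
    subject to the transformation law under [transition]; a tangent vector read
    in a chart is a row vector, and an endomorphism A acts by v |-> v *m A. *)

Definition bform (R : realType) (m : nat) (G : 'M[R]_m) (u v : 'rV[R]_m) : R :=
  (u *m G *m v^T) 0 0.

Record riemannian_metric (R : realType) (m : nat) (N : manifold R m) :=
  RiemannianMetric {
  gmx :> chart R m N -> 'rV[R]_m -> 'M[R]_m;
  gmx_smooth : forall c, atlas c -> smooth_on (cimg c) (gmx c);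
  gmx_sym : forall c x, atlas c -> cimg c x -> (gmx c x)^T = gmx c x;
  gmx_posdef : forall c x u, atlas c -> cimg c x -> u != 0 ->
    0 < bform (gmx c x) u u;
  gmx_transition : forall c c' p u v, atlas c -> atlas c' ->
    cdom c p -> cdom c' p ->
    bform (gmx c' (cmap c' p)) ('d (transition c c') (cmap c p) u)
                                ('d (transition c c') (cmap c p) v)
    = bform (gmx c (cmap c p)) u v }.

Record almost_complex_structure (R : realType) (m : nat) (N : manifold R m) :=
  AlmostComplexStructure {
  jmx :> chart R m N -> 'rV[R]_m -> 'M[R]_m;
  jmx_smooth : forall c, atlas c -> smooth_on (cimg c) (jmx c);
  jmx_sqr : forall c x, atlas c -> cimg c x -> jmx c x *m jmx c x = - 1%:M;
  jmx_transition : forall c c' p u, atlas c -> atlas c' ->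
    cdom c p -> cdom c' p ->
    'd (transition c c') (cmap c p) u *m jmx c' (cmap c' p)
    = 'd (transition c c') (cmap c p) (u *m jmx c (cmap c p)) }.

Record almost_hermitian_manifold (R : realType) (m : nat) :=
  AlmostHermitianManifold {
  ah_manifold :> manifold R m;
  metric : riemannian_metric ah_manifold;
  acs : almost_complex_structure ah_manifold;
  metric_acs : forall c x u v, atlas c -> cimg c x ->
    bform (metric c x) (u *m acs c x) (v *m acs c x)
    = bform (metric c x) u v }.

(** Levi-Civita connection in a chart. *)

(* The vector Gamma(u, v), with
   Gamma^k_ij = 1/2 g^kl (d_i g_jl + d_j g_il - d_l g_ij). *)
Definition christoffel (R : realType) (m : nat) (G : 'rV[R]_m -> 'M[R]_m)
    (x u v : 'rV[R]_m) : 'rV[R]_m :=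
  2^-1 *: (v *m 'D_u G x + u *m 'D_v G x
           - \row_l bform ('D_(delta_mx 0 l) G x) u v) *m invmx (G x).

(* Covariant derivative at F x, in the direction 'd F x u, of a vector field V
   along the map F. *)
Definition covd_along (R : realType) (n m : nat) (G : 'rV[R]_m -> 'M[R]_m)
    (F : 'rV[R]_n -> 'rV[R]_m) (V : 'rV[R]_n -> 'rV[R]_m)
    (u x : 'rV[R]_n) : 'rV[R]_m :=
  'D_u V x + christoffel G (F x) ('d F x u) (V x).

Definition covd (R : realType) (m : nat) (G : 'rV[R]_m -> 'M[R]_m)
    (V : 'rV[R]_m -> 'rV[R]_m) (u x : 'rV[R]_m) : 'rV[R]_m :=
  'D_u V x + christoffel G x u (V x).

(* nabla J = 0, i.e. (nabla_u J) V = nabla_u (J V) - J (nabla_u V) vanishes. *)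
Definition kaehler (R : realType) (m : nat)
    (N : almost_hermitian_manifold R m) : Prop :=
  forall (c : chart R m N) (V : 'rV[R]_m -> 'rV[R]_m) (x u : 'rV[R]_m),
    atlas c -> smooth_on (cimg c) V -> cimg c x ->
    covd (metric N c) (fun y => V y *m acs N c y) u x
    = covd (metric N c) V u x *m acs N c x.

Lemma is_derive_scale (R : realType) (m : nat) (V : normedModType R)
    (k : V -> R) (g : V -> 'rV[R]_m) (x u : V) :
  derivable k x u -> derivable g x u ->
  is_derive x u (fun y => k y *: g y) ('D_u k x *: g x + k x *: 'D_u g x).
Proof.
move=> dk dg; have dgj j := (derivable_mxP _ _ _).1 dg 0 j.
have dkg j : is_derive x u (fun y => (k y *: g y) 0 j)
    ('D_u k x * g x 0 j + k x * 'D_u (fun y => g y 0 j) x).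
  have := is_deriveM (derivableP dk) (derivableP (dgj j)).
  rewrite (_ : k * _ = (fun y => (k y *: g y) 0 j)); last first.
    by apply/funext => y; rewrite mxE.
  move=> /is_derive_eq; apply.
  by rewrite /GRing.scale /= addrC mulrC.
have d : derivable (fun y => k y *: g y) x u.
  by apply/derivable_mxP => i j; rewrite ord1; case: (dkg j).
apply: DeriveDef => //; rewrite derive_mx//; apply/rowP => j.
rewrite mxE; have [_ ->] := dkg j.
by do 3![rewrite [in RHS]mxE]; rewrite [in RHS](derive_mx dg) [in RHS]mxE.
Qed.

(** Submanifolds, given by immersions. *)

Section Submanifold.
Variables (R : realType) (n m : nat).
Variables (M : manifold R n) (N : almost_hermitian_manifold R m) (f : M -> N).

Definition local_rep (c : chart R n M) (d : chart R m N)
    : 'rV[R]_n -> 'rV[R]_m := cmap d \o f \o cpar c.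

Definition smooth_map : Prop := continuous f /\
  forall (c : chart R n M) (d : chart R m N), atlas c -> atlas d ->
    smooth_on (cmap c @` (cdom c `&` f @^-1` cdom d)) (local_rep c d).

(* [c] and [d] are charts around [p] and [f p]. *)
Definition adapted (p : M) (c : chart R n M) (d : chart R m N) : Prop :=
  [/\ atlas c, atlas d, cdom c p & cdom d (f p)].

(* The differential of f at p, read in c and d. *)
Definition dmap (p : M) (c : chart R n M) (d : chart R m N)
    (u : 'rV[R]_n) : 'rV[R]_m := 'd (local_rep c d) (cmap c p) u.

Definition immersion : Prop := smooth_map /\
  forall p c d, adapted p c d -> injective (dmap p c d).

Definition tangent_space (p : M) (c : chart R n M) (d : chart R m N)
    : set 'rV[R]_m := range (dmap p c d).

Definition ambient_metric (p : M) (d : chart R m N) : 'rV[R]_m -> 'rV[R]_m -> R :=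
  bform (metric N d (cmap d (f p))).

Definition normal_space (p : M) (c : chart R n M) (d : chart R m N)
    : set 'rV[R]_m :=
  [set w | forall t, tangent_space p c d t -> ambient_metric p d t w = 0].

Definition lagrangian : Prop := forall p c d, adapted p c d ->
  (fun t => t *m acs N d (cmap d (f p))) @` tangent_space p c d
  = normal_space p c d.

Definition induced_metric (p : M) (c : chart R n M) (d : chart R m N)
    (u v : 'rV[R]_n) : R :=
  ambient_metric p d (dmap p c d u) (dmap p c d v).

Definition normal_part (p : M) (c : chart R n M) (d : chart R m N)
    (w : 'rV[R]_m) : 'rV[R]_m :=
  xget 0 [set z | normal_space p c d z /\ tangent_space p c d (w - z)].

(* sigma(X, Y), the normal part of nabla_X Y, where the tangent field Y along M
   has constant components v in c; see [sff_extension] for other fields. *)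
Definition sff (p : M) (c : chart R n M) (d : chart R m N)
    (u v : 'rV[R]_n) : 'rV[R]_m :=
  normal_part p c d
    (covd_along (metric N d) (local_rep c d)
       (fun y => 'd (local_rep c d) y v) u (cmap c p)).

(* (1/n) sum_ij g^ij sigma(e_i, e_j), g^ij the inverse of the induced metric *)
Definition mean_curvature (p : M) (c : chart R n M) (d : chart R m N)
    : 'rV[R]_m :=
  let gram := \matrix_(i, j)
    induced_metric p c d (delta_mx 0 i) (delta_mx 0 j) : 'M[R]_n in
  n%:R^-1 *: \sum_(i < n) \sum_(j < n)
    invmx gram i j *: sff p c d (delta_mx 0 i) (delta_mx 0 j).

Definition totally_umbilical : Prop := forall p c d, adapted p c d ->
  forall u v, sff p c d u v = induced_metric p c d u v *: mean_curvature p c d.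

Definition totally_geodesic : Prop := forall p c d, adapted p c d ->
  forall u v, sff p c d u v = 0.

Lemma normal_part_tangent p c d w u :
  normal_part p c d (w + dmap p c d u) = normal_part p c d w.
Proof.
congr (xget _ _); apply/seteqP; split=> z [nz [t _ tE]]; split=> //.
  exists (t - u) => //; rewrite /dmap linearB /= -!/(dmap _ _ _ _) tE.
  by rewrite addrAC addrK.
exists (t + u) => //; rewrite /dmap linearD /= -!/(dmap _ _ _ _) tE.
by rewrite addrAC.
Qed.

Lemma local_rep_domain_open (c : chart R n M) (d : chart R m N) : continuous f ->
  open (cmap c @` (cdom c `&` f @^-1` cdom d)).
Proof.
move=> fc; rewrite openE => _ [p [cp dp] <-] /=.
have cimgp : (cimg c) (cmap c p) by exists p.
have : \forall x \near cmap c p, (cdom c `&` f @^-1` cdom d) (cpar c x).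
  apply: (@cpar_continuous _ _ _ c _ cimgp); rewrite cmapK//.
  apply: open_nbhs_nbhs; split=> //; apply: openI; first exact: cdom_open.
  by apply: open_comp; [move=> ? _; exact: fc | exact: cdom_open].
have : \forall x \near cmap c p, cimg c x.
  by apply: open_nbhs_nbhs; split=> //; exact: cimg_open.
apply: filterS2 => x [q cq <-]; rewrite cmapK// => qq; by exists q.
Qed.

Lemma sff_extension (p : M) (c : chart R n M) (d : chart R m N)
    (u : 'rV[R]_n) (Y : 'rV[R]_n -> 'rV[R]_n) :
  smooth_map -> adapted p c d -> differentiable Y (cmap c p) ->
  normal_part p c d
    (covd_along (metric N d) (local_rep c d)
       (fun y => 'd (local_rep c d) y (Y y)) u (cmap c p))
  = sff p c d u (Y (cmap c p)).
Proof.
move=> [fc fs] [ac ad cp dp] dY.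
set F := local_rep c d; set x := cmap c p.
have Ux : (cmap c @` (cdom c `&` f @^-1` cdom d)) x by exists p.
have nU : \forall y \near x, (cmap c @` (cdom c `&` f @^-1` cdom d)) y.
  by apply: open_nbhs_nbhs; split=> //; exact: local_rep_domain_open.
have [dF dF2] := fs c d ac ad 2.
have dFv v : derivable (fun y => 'd F y v) x u.
  apply: (@near_eq_derivable _ _ _ (fun y => 'D_v F y)).
    by apply: filterS nU => y Uy; rewrite deriveE//; exact: dF.
  by apply: diff_derivable; have [+ _] := dF2 v; apply.
have dYj j : derivable (fun y => Y y 0 j) x u.
  by apply: ((derivable_mxP _ _ _).1 (diff_derivable dY) 0 j).
have dFE y v : 'd F y v = \sum_j v 0 j *: 'd F y (delta_mx 0 j).
  rewrite {1}(row_sum_delta v) linear_sum; apply: eq_bigr => j _.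
  by rewrite linearZ.
have dG : is_derive x u (fun y => 'd F y (Y y))
    (\sum_j ('D_u (fun y => Y y 0 j) x *: 'd F x (delta_mx 0 j)
             + Y x 0 j *: 'D_u (fun y => 'd F y (delta_mx 0 j)) x)).
  rewrite (_ : (fun y => 'd F y (Y y)) =
      \sum_j (fun y => Y y 0 j *: 'd F y (delta_mx 0 j))); last first.
    by apply/funext => y; rewrite fct_sumE; exact: dFE.
  by apply: is_derive_sum => j; exact: is_derive_scale.
have dH : is_derive x u (fun y => 'd F y (Y x))
    (\sum_j Y x 0 j *: 'D_u (fun y => 'd F y (delta_mx 0 j)) x).
  rewrite (_ : (fun y => 'd F y (Y x)) =
      \sum_j (Y x 0 j *: (fun y => 'd F y (delta_mx 0 j)))); last first.
    by apply/funext => y; rewrite fct_sumE; exact: dFE.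
  by apply: is_derive_sum => j; apply: is_deriveZ; exact: derivableP.
rewrite /sff /covd_along -/F -/x (@derive_val _ _ _ _ _ _ _ dG).
rewrite (@derive_val _ _ _ _ _ _ _ dH) big_split/=.
have -> : \sum_j 'D_u (fun y => Y y 0 j) x *: 'd F x (delta_mx 0 j)
    = dmap p c d ('D_u Y x).
  rewrite /dmap -/F -/x [RHS]dFE; apply: eq_bigr => j _.
  by rewrite (derive_mx (diff_derivable dY)) mxE.
by rewrite -addrA [X in normal_part _ _ _ X]addrC normal_part_tangent.
Qed.

End Submanifold.

(* Main.v *)
Require Import Defs.
From mathcomp Require Import all_boot all_order all_algebra.
From mathcomp Require Import all_classical all_reals all_analysis.
From mathcomp Require Import ring.

(** Fix a point of M and charts around it, let F be the map f read in these
    charts, and write nabla_u v for the ambient covariant derivative along F of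
    the coordinate field dF v in the direction u.  The Lagrangian condition
    says that g(dF v, J dF w) vanishes identically.  Differentiating this
    identity in the direction u, with nabla g = 0 and nabla J = 0, gives
        g(nabla_u v, J dF w) = - g(dF v, J nabla_u w) = g(nabla_u w, J dF v).
    As J dF w is normal, nabla can be replaced by the second fundamental form
    sigma, and the cubic form C(u, v, w) = g(sigma(u, v), J dF w) is symmetric
    in v and w ([cubic_form_sym] and [ambient_sff]).

    If M is totally umbilical this reads g(u, v) h(w) = g(u, w) h(v), where
    h(w) = g(H, J dF w).  When the dimension n is at least 2, every w admits a
    nonzero e that is orthogonal to it, and u = v = e yields h(w) = 0
    ([umbilical_curvature_orthogonal]).  Now sigma(u, v) is normal, hence of
    the form J dF w, so that |sigma(u, v)|^2 = g(u, v) h(w) = 0.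

    The analysis needed is the Leibniz rule for matrix products and the chain
    rule, which give the compatibility of the Christoffel symbols with the
    metric ([christoffel_metric]) and with J ([kaehler_derive_acs]), first at
    a point and then along F.  The linear algebra is that of Gram matrices:
    the normal part of a vector is only meaningful once the orthogonal
    projection onto the tangent space is known to exist
    ([normal_part_spec]). *)

Set Implicit Arguments.
Unset Strict Implicit.
Unset Printing Implicit Defensive.
Import Order.TTheory GRing.Theory Num.Theory.
Import numFieldNormedType.Exports.

Local Open Scope classical_set_scope.
Local Open Scope ring_scope.

(** * Bilinear forms given by matrices *)

Section Bform.
Variables (R : realType) (m : nat).
Implicit Types (G : 'M[R]_m) (u v w : 'rV[R]_m).

Lemma bformDl G u v w : bform G (u + v) w = bform G u w + bform G v w.
Proof. by rewrite /bform !mulmxDl mxE. Qed.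

Lemma bformDr G u v w : bform G w (u + v) = bform G w u + bform G w v.
Proof. by rewrite /bform linearD /= mulmxDr mxE. Qed.

Lemma bformZl G k u w : bform G (k *: u) w = k * bform G u w.
Proof. by rewrite /bform -!scalemxAl mxE. Qed.

Lemma bformNr G u w : bform G w (- u) = - bform G w u.
Proof. by rewrite /bform linearN /= mulmxN mxE. Qed.

Lemma bformC G u v : G^T = G -> bform G u v = bform G v u.
Proof.
move=> GT; rewrite /bform -[LHS](mxE trmx_key (fun i j => (u *m G *m v^T) j i)).
by rewrite -/(trmx _) !trmx_mul trmxK GT mulmxA.
Qed.

(** A vector of the kernel of G is isotropic. *)
Lemma posdef_unitmx G :
  (forall u, u != 0 -> 0 < bform G u u) -> G \in unitmx.
Proof.
move=> Gpos; rewrite -row_free_unit -kermx_eq0; apply/eqP/row_matrixP => i.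
rewrite row0; apply/eqP/negP => /negP/Gpos.
by rewrite /bform -row_mul mulmx_ker row0 mul0mx mxE ltxx.
Qed.

End Bform.

(** * Derivatives of matrix-valued functions *)

Section Derivatives.
Variables (R : realType) (V : normedModType R).

Lemma is_derive_mxP a b (A : V -> 'M[R]_(a, b)) dA x u :
  is_derive x u A dA <->
  forall i j, is_derive x u (fun y => A y i j) (dA i j).
Proof.
split=> [[dr <-] i j|dij].
  by split; [exact: ((derivable_mxP _ _ _).1 dr)|rewrite derive_mx// mxE].
have dr : derivable A x u by apply/derivable_mxP => i j; case: (dij i j).
split=> //; rewrite derive_mx//; apply/matrixP => i j.
by rewrite mxE; case: (dij i j).
Qed.

Lemma is_derive_mulmx a b c (A : V -> 'M[R]_(a, b)) (B : V -> 'M[R]_(b, c))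
    dA dB x u :
  is_derive x u A dA -> is_derive x u B dB ->
  is_derive x u (fun y => A y *m B y) (dA *m B x + A x *m dB).
Proof.
move=> /is_derive_mxP hA /is_derive_mxP hB; apply/is_derive_mxP => i j.
have -> : (fun y => (A y *m B y) i j) =
    \sum_k ((fun y => A y i k) * (fun y => B y k j)).
  by apply/funext => y; rewrite fct_sumE mxE; apply: eq_bigr.
have hAB k := is_deriveM (hA i k) (hB k j).
apply: is_derive_eq (is_derive_sum hAB) _.
rewrite !mxE -big_split/=.
by apply: eq_bigr => k _; rewrite [LHS]addrC; congr (_ + _); exact: mulrC.
Qed.

Lemma is_derive_trmx a b (A : V -> 'M[R]_(a, b)) dA x u :
  is_derive x u A dA -> is_derive x u (fun y => (A y)^T) dA^T.
Proof.
move=> /is_derive_mxP hA; apply/is_derive_mxP => i j; rewrite mxE.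
by rewrite (_ : (fun y => _) = (fun y => A y j i))//; apply/funext => y; rewrite mxE.
Qed.

Lemma is_derive_bform m (G : V -> 'M[R]_m) (v w : V -> 'rV[R]_m) dG dv dw x u :
  is_derive x u G dG -> is_derive x u v dv -> is_derive x u w dw ->
  is_derive x u (fun y => bform (G y) (v y) (w y))
    (bform dG (v x) (w x) + bform (G x) dv (w x) + bform (G x) (v x) dw).
Proof.
move=> hG hv hw.
have h := (is_derive_mxP _ _ _ _).1
  (is_derive_mulmx (is_derive_mulmx hv hG) (is_derive_trmx hw)) 0 0.
apply: is_derive_eq h _; rewrite mulmxDl.
have mxD (A B : 'M[R]_1) : (A + B) 0 0 = A 0 0 + B 0 0 by rewrite mxE.
rewrite (mxD (_ + _)) (mxD (dv *m _ *m _)); congr (_ + _).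
by rewrite addrC.
Qed.

(** The chain rule, in the form in which a direction u at x is pushed forward
    to the direction 'd f x u at f x. *)
Lemma is_derive_comp_diff (U W : normedModType R) (f : V -> U) (g : U -> W) x u :
  differentiable f x -> differentiable g (f x) ->
  is_derive x u (g \o f) ('D_('d f x u) g (f x)).
Proof.
move=> df dg; have dgf := differentiable_comp df dg.
by split; [exact: diff_derivable|rewrite (deriveE _ dgf) (deriveE _ dg) diff_comp].
Qed.

End Derivatives.

(** * The Levi-Civita connection and the complex structure in a chart *)

Section Connection.
Variables (R : realType) (m : nat) (G : 'rV[R]_m -> 'M[R]_m).

Lemma derive_sym q u :
  (\forall y \near q, (G y)^T = G y) -> derivable G q u ->
  ('D_u G q)^T = 'D_u G q.
Proof.
move=> Gsym /derivableP/is_derive_trmx dG.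
rewrite -[LHS](@derive_val _ _ _ _ _ _ _ dG).
exact: near_eq_derive.
Qed.

(** The Koszul formula for coordinate fields: lowering the index of the
    Christoffel symbols cancels the inverse metric. *)
Lemma christoffel_bform q u v w : differentiable G q -> G q \in unitmx ->
  bform (G q) (christoffel G q u v) w =
  2^-1 * (bform ('D_u G q) v w + bform ('D_v G q) u w - bform ('D_w G q) u v).
Proof.
move=> dG Gu.
rewrite {1}/bform /christoffel -!scalemxAl mulmxKV// mxE; congr (_ * _).
rewrite 2!mulmxDl mulNmx.
have mxD (A B : 'M[R]_1) : (A + B) 0 0 = A 0 0 + B 0 0 by rewrite mxE.
have mxN (A : 'M[R]_1) : (- A) 0 0 = - A 0 0 by rewrite mxE.
rewrite 2!mxD mxN; congr (_ + _ - _).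
rewrite mxE [in RHS]deriveE// [in RHS](row_sum_delta w) linear_sum /bform.
rewrite mulmx_sumr mulmx_suml summxE; apply: eq_bigr => l _.
rewrite linearZ /= -scalemxAr -scalemxAl mxE -deriveE//.
by rewrite [w^T _ _]mxE [RHS]mxE [RHS]mulrC.
Qed.

(** The metric is parallel: in the two Koszul formulas, the derivatives of G
    along v and along w cancel, and those along u add up. *)
Lemma christoffel_metric q u v w :
  differentiable G q -> G q \in unitmx ->
  (\forall y \near q, (G y)^T = G y) ->
  bform ('D_u G q) v w =
  bform (G q) (christoffel G q u v) w + bform (G q) v (christoffel G q u w).
Proof.
move=> dG Gu Gsym.
rewrite [X in _ + X]bformC; last exact: nbhs_singleton Gsym.
rewrite (christoffel_bform u v w dG Gu) (christoffel_bform u w v dG Gu).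
have cancel (a b c a' : R) :
    a' = a -> a = 2^-1 * (a + b - c) + 2^-1 * (a' + c - b).
  by move=> ->; field.
exact: cancel (bformC w v (derive_sym Gsym (diff_derivable dG))).
Qed.

(** The Leibniz rule for the metric and the covariant derivative along F. *)
Lemma is_derive_metric_along n (F : 'rV[R]_n -> 'rV[R]_m)
    (V W : 'rV[R]_n -> 'rV[R]_m) x u :
  differentiable F x -> differentiable G (F x) -> G (F x) \in unitmx ->
  (\forall y \near F x, (G y)^T = G y) ->
  derivable V x u -> derivable W x u ->
  is_derive x u (fun y => bform (G (F y)) (V y) (W y))
    (bform (G (F x)) (covd_along G F V u x) (W x)
     + bform (G (F x)) (V x) (covd_along G F W u x)).
Proof.
move=> dF dG Gu Gsym /derivableP dV /derivableP dW.
apply: is_derive_eq (is_derive_bform (is_derive_comp_diff u dF dG) dV dW) _.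
rewrite christoffel_metric// /covd_along bformDl bformDr; ring.
Qed.

End Connection.

Lemma smooth_on_cst (R : realType) n (W : normedModType R) (U : set 'rV[R]_n)
  (w : W) : smooth_on U (fun=> w).
Proof.
move=> k; elim: k w => [w x _|k IH w] /=; first exact: cst_continuous.
split=> [x _|v]; first exact: differentiable_cst.
have -> : (fun x : 'rV[R]_n => 'D_v (fun=> w) x) = fun=> 0; last exact: IH.
by apply/funext => x; exact: derive_cst.
Qed.

(** The Kaehler condition, which quantifies over vector fields, is here tested
    on the field with constant components v; this gives nabla J = 0 at a point
    as an identity between components. *)
Lemma kaehler_derive_acs (R : realType) m (N : almost_hermitian_manifold R m)
    (d : chart R m N) q u v :
  kaehler N -> atlas d -> cimg d q ->
  v *m 'D_u (acs N d) q =
  christoffel (metric N d) q u v *m acs N d q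
  - christoffel (metric N d) q u (v *m acs N d q).
Proof.
move=> K ad dq.
have := K d (fun=> v) q u ad (smooth_on_cst (cimg d) v) dq.
have [dJ _] := jmx_smooth (acs N) ad 1%N.
have hJ := is_derive_mulmx (is_derive_cst v q u)
  (derivableP (diff_derivable (dJ q dq) (v := u))).
rewrite /covd derive_cst add0r (@derive_val _ _ _ _ _ _ _ hJ) mul0mx add0r.
by move=> <-; rewrite addrK.
Qed.

(** The covariant derivative along F commutes with J. *)
Lemma kaehler_covd_along (R : realType) n m (N : almost_hermitian_manifold R m)
    (d : chart R m N) (F W : 'rV[R]_n -> 'rV[R]_m) x u :
  kaehler N -> atlas d -> cimg d (F x) -> differentiable F x ->
  derivable W x u ->
  derivable (fun y => W y *m acs N d (F y)) x u /\
  covd_along (metric N d) F (fun y => W y *m acs N d (F y)) u x =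
  covd_along (metric N d) F W u x *m acs N d (F x).
Proof.
move=> K ad dq dF /derivableP dW.
have [dJ _] := jmx_smooth (acs N) ad 1%N.
have hJ := is_derive_mulmx dW (is_derive_comp_diff u dF (dJ _ dq)).
split; first by case: hJ.
rewrite /covd_along (@derive_val _ _ _ _ _ _ _ hJ) /= kaehler_derive_acs//.
by rewrite mulmxDl -!addrA addNr addr0.
Qed.

(** * Orthogonality with respect to a Gram matrix *)

(** The coefficients t solve the normal equations t K = w G A^T for the Gram
    matrix K of the rows of A, which is positive definite, hence invertible. *)
Lemma orthogonal_projection (R : realType) m n (G : 'M[R]_m) (A : 'M[R]_(n, m))
    (w : 'rV[R]_m) :
  G^T = G -> (forall u, u != 0 -> 0 < bform G u u) -> row_free A ->
  exists t : 'rV[R]_n, forall s : 'rV[R]_n, bform G (s *m A) (w - t *m A) = 0.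
Proof.
move=> GT Gpos Afree; pose K := A *m G *m A^T.
have Kunit : K \in unitmx.
  apply: posdef_unitmx => u u0.
  have -> : bform K u u = bform G (u *m A) (u *m A).
    by rewrite /bform /K trmx_mul !mulmxA.
  apply: Gpos; apply: contra_neq u0 => uA.
  by apply/eqP; rewrite -(mulmx_free_eq0 u Afree) uA.
pose t := w *m G *m A^T *m invmx K.
have tK : t *m A *m G *m A^T = w *m G *m A^T.
  by rewrite -!(mulmxA t) -/K mulmxKV.
exists t => s; rewrite bformC// /bform trmx_mul mulmxA 2!mulmxBl tK.
by rewrite subrr mul0mx mxE.
Qed.

(** The vectors orthogonal to w form the kernel of one column of n entries. *)
Lemma exists_orthogonal (R : realType) n (K : 'M[R]_n) (w : 'rV[R]_n) :
  (1 < n)%N -> exists2 e, e != 0 & bform K e w = 0.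
Proof.
move=> n1; have : kermx (K *m w^T) != 0.
  rewrite kermx_eq0 /row_free neq_ltn; apply/orP; left.
  exact: leq_ltn_trans (rank_leq_col _) n1.
move=> /eqP/row_matrixP K0; apply/not_exists2P => none.
case: K0 => i; rewrite row0; apply/eqP/negPn/negP => ri0.
case: (none (row i (kermx (K *m w^T)))) => // -[].
by rewrite /bform -mulmxA -row_mul mulmx_ker row0 mxE.
Qed.

(** * Lagrangian immersions *)

Section LagrangianGeometry.
Variables (R : realType) (n m : nat) (M : manifold R n).
Variables (N : almost_hermitian_manifold R m) (f : M -> N).

Lemma local_repE p c d : adapted f p c d ->
  local_rep f c d (cmap c p) = cmap d (f p).
Proof. by case=> _ _ cp _; rewrite /local_rep /= cmapK. Qed.

(** Every point of the chart near cmap c p is the coordinate of a point that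
    the same two charts serve, so that hypotheses at points of M become
    identities on an open set of coordinates, which can be differentiated. *)
Lemma near_adapted p c d : continuous f -> adapted f p c d ->
  \forall y \near cmap c p, exists2 q, adapted f q c d & cmap c q = y.
Proof.
move=> fc [ac ad cp dp].
have : nbhs (cmap c p) (cmap c @` (cdom c `&` f @^-1` cdom d)).
  by apply: open_nbhs_nbhs; split; [exact: local_rep_domain_open|exists p].
by apply: filterS => _ [q [cq dq] <-]; exists q.
Qed.

Lemma local_rep_differentiable p c d : smooth_map f -> adapted f p c d ->
  differentiable (local_rep f c d) (cmap c p).
Proof.
move=> [_ fs] [ac ad cp dp]; have [dF _] := fs c d ac ad 1%N.
by apply: dF; exists p.
Qed.

Lemma derivable_dmap p c d u v : smooth_map f -> adapted f p c d ->
  derivable (fun y => 'd (local_rep f c d) y v) (cmap c p) u.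
Proof.
move=> fs apcd; have [fc fs'] := fs; have [ac ad cp dp] := apcd.
apply: (@near_eq_derivable _ _ _ (fun y => 'D_v (local_rep f c d) y)).
  apply: filterS (near_adapted fc apcd) => _ [q aq <-].
  by rewrite deriveE//; exact: local_rep_differentiable.
have [_ dF2] := fs' c d ac ad 2%N; have [+ _] := dF2 v.
by move=> /(_ (cmap c p)) dF; apply: diff_derivable; apply: dF; exists p.
Qed.

Lemma near_metric_sym (d : chart R m N) q : atlas d -> cdom d q ->
  \forall y \near cmap d q, (metric N d y)^T = metric N d y.
Proof.
move=> ad dq; have : nbhs (cmap d q) (cimg d).
  by apply: open_nbhs_nbhs; split; [exact: cimg_open|exists q].
by apply: filterS => y dy; exact: gmx_sym.
Qed.

Lemma metric_posdef p c d u : adapted f p c d -> u != 0 ->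
  0 < ambient_metric f p d u u.
Proof. by move=> [_ ad _ dp]; apply: gmx_posdef => //; exists (f p). Qed.

Lemma ambient_metricC p c d u v : adapted f p c d ->
  ambient_metric f p d u v = ambient_metric f p d v u.
Proof.
by move=> [_ ad _ dp]; apply: bformC; apply: gmx_sym => //; exists (f p).
Qed.

(** [normal_part] is chosen among the normal vectors differing from w by a
    tangent one, and this set is not empty: the Gram matrix of the images of the
    basis vectors is invertible since f is an immersion. *)
Lemma normal_part_spec p c d w : immersion f -> adapted f p c d ->
  Defs.normal_space f p c d (normal_part f p c d w) /\
  tangent_space f p c d (w - normal_part f p c d w).
Proof.
move=> [_ fi] apcd; have [_ ad _ dp] := apcd.
pose A := lin1_mx ('d (local_rep f c d) (cmap c p)).
have dE t : dmap f p c d t = t *m A by rewrite mul_rV_lin1.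
have Afree : row_free A.
  rewrite -kermx_eq0; apply/eqP/row_matrixP => i; rewrite row0.
  by apply: (fi p c d apcd); rewrite !dE -row_mul mulmx_ker row0 mul0mx.
have dcimg : cimg d (cmap d (f p)) by exists (f p).
have [t tP] := orthogonal_projection w (gmx_sym (metric N) ad dcimg)
  (fun u => gmx_posdef (metric N) ad dcimg (u := u)) Afree.
rewrite /normal_part; case: xgetP => [z _ //|/(_ (w - t *m A))[]].
split=> [_ [s _ <-]|]; first by rewrite dE; exact: tP.
by exists t => //; rewrite dE opprB addrC subrK.
Qed.

(** The vector of which [sff] takes the normal part. *)
Definition nabla_dmap p c d u v :=
  covd_along (metric N d) (local_rep f c d)
    (fun y => 'd (local_rep f c d) y v) u (cmap c p).

Lemma lagrangian_orthogonal p c d v w : lagrangian f -> adapted f p c d ->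
  ambient_metric f p d (dmap f p c d v)
    (dmap f p c d w *m acs N d (cmap d (f p))) = 0.
Proof.
move=> fL apcd.
have : Defs.normal_space f p c d (dmap f p c d w *m acs N d (cmap d (f p))).
  by rewrite -(fL p c d apcd); exists (dmap f p c d w) => //; exists w.
by apply; exists v.
Qed.

(** The derivative along u of the constant function g(dF v, J dF w) = 0 is
    g(nabla_u v, J dF w) + g(dF v, J nabla_u w), and J is a skew isometry. *)
Lemma cubic_form_sym p c d u v w : smooth_map f -> kaehler N ->
  lagrangian f -> adapted f p c d ->
  ambient_metric f p d (nabla_dmap p c d u v)
    (dmap f p c d w *m acs N d (cmap d (f p))) =
  ambient_metric f p d (nabla_dmap p c d u w)
    (dmap f p c d v *m acs N d (cmap d (f p))).
Proof.
move=> fs K fL apcd; have [fc _] := fs; have [_ ad _ dp] := apcd.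
have FE := local_repE apcd.
have dF := local_rep_differentiable fs apcd.
have dcimg : cimg d (cmap d (f p)) by exists (f p).
set F := local_rep f c d in FE dF *; set x := cmap c p in FE dF *.
pose V z y := 'd F y z.
have dV z : derivable (V z) x u by exact: derivable_dmap.
have dFcimg : cimg d (F x) by rewrite FE.
have [dJV covdJ] := kaehler_covd_along K ad dFcimg dF (dV w).
have [dG _] := gmx_smooth (metric N) ad 1%N.
have Gu : metric N d (F x) \in unitmx.
  by apply: posdef_unitmx => z; exact: gmx_posdef.
have Gsym : \forall y \near F x, (metric N d y)^T = metric N d y.
  by rewrite FE; exact: near_metric_sym.
have dphi := is_derive_metric_along dF (dG _ dFcimg) Gu Gsym (dV v) dJV.
have phi0 : \forall y \near x,
    bform (metric N d (F y)) (V v y) (V w y *m acs N d (F y)) = (fun=> 0) y.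
  apply: filterS (near_adapted fc apcd) => _ [q aq <-].
  by rewrite /F local_repE//; exact: lagrangian_orthogonal.
have := near_eq_derive u phi0.
rewrite derive_cst (@derive_val _ _ _ _ _ _ _ dphi).
rewrite covdJ FE => /eqP; rewrite addr_eq0 => /eqP.
rewrite -/(nabla_dmap p c d u v).
rewrite /ambient_metric => ->.
(* Apply the isometry J to both arguments and use J^2 = -1. *)
rewrite -(metric_acs _ _ ad dcimg) -mulmxA jmx_sqr// mulmxN mulmx1 bformNr opprK.
by rewrite -!/(ambient_metric f p d _ _) (ambient_metricC _ _ apcd).
Qed.

End LagrangianGeometry.

(** * Totally umbilical Lagrangian immersions *)

Section Umbilical.
Variables (R : realType) (n m : nat) (M : manifold R n).
Variables (N : almost_hermitian_manifold R m) (f : M -> N).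

(** J dF w is normal, so pairing with it kills the tangent part. *)
Lemma ambient_sff p c d u v w : immersion f -> lagrangian f ->
  adapted f p c d ->
  ambient_metric f p d (sff f p c d u v)
    (dmap f p c d w *m acs N d (cmap d (f p))) =
  ambient_metric f p d (nabla_dmap f p c d u v)
    (dmap f p c d w *m acs N d (cmap d (f p))).
Proof.
move=> fi fL apcd.
have [_ [t _ tE]] := normal_part_spec (nabla_dmap f p c d u v) fi apcd.
rewrite -[in RHS](subrK (sff f p c d u v) (nabla_dmap f p c d u v)).
rewrite [in RHS]/ambient_metric bformDl -!/(ambient_metric f p d _ _) -tE.
by rewrite lagrangian_orthogonal// add0r.
Qed.

Lemma induced_metric_gt0 p c d u : immersion f -> adapted f p c d -> u != 0 ->
  0 < induced_metric f p c d u u.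
Proof.
move=> [_ fi] apcd u0; apply: (metric_posdef apcd).
by apply: contra_neq u0 => du0; apply: (fi p c d apcd); rewrite du0 /dmap linear0.
Qed.

Lemma induced_metric_orthogonal p c d w : (1 < n)%N ->
  exists2 e, e != 0 & induced_metric f p c d e w = 0.
Proof.
move=> n1; pose A := lin1_mx ('d (local_rep f c d) (cmap c p)).
pose K := A *m metric N d (cmap d (f p)) *m A^T.
have [e e0 ew] := exists_orthogonal K w n1; exists e => //.
rewrite -ew /induced_metric /ambient_metric /dmap -!mul_rV_lin1 -/A.
by rewrite /bform trmx_mul !mulmxA.
Qed.

(** Choose e orthogonal to w; the symmetry of the cubic form on (e, e, w) reads
    g(e, e) h(w) = g(e, w) h(e) = 0, where h(w) = g(H, J dF w). *)
Lemma umbilical_curvature_orthogonal p c d w : immersion f -> kaehler N ->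
  lagrangian f -> totally_umbilical f -> (1 < n)%N -> adapted f p c d ->
  ambient_metric f p d (mean_curvature f p c d)
    (dmap f p c d w *m acs N d (cmap d (f p))) = 0.
Proof.
move=> fi K fL fU n1 apcd; have [e e0 ew] := induced_metric_orthogonal p c d w n1.
have [fs _] := fi.
have := cubic_form_sym e e w fs K fL apcd.
rewrite -!ambient_sff// !(fU p c d apcd) ew scale0r.
rewrite /ambient_metric bformZl [RHS]/bform !mul0mx mxE => /eqP.
by rewrite mulf_eq0 gt_eqF ?induced_metric_gt0//= => /eqP.
Qed.

End Umbilical.

Theorem theorem5p3 (R : realType) (n m : nat) (M : manifold R n)
    (N : almost_hermitian_manifold R m) (f : M -> N)
    (f_immersion : immersion f)
    (N_kaehler : kaehler N)
    (f_lagrangian : lagrangian f)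
    (f_umbilical : totally_umbilical f) :
  n = 1%N \/ totally_geodesic f.
Proof.
have [n1|n1] := eqVneq n 1%N; [by left|right=> p c d apcd u v].
case: (posnP n) => [n0|n_gt0].
  rewrite f_umbilical// /mean_curvature.
  (* In dimension 0 the factor 1/n of the mean curvature is 0^-1 = 0. *)
  have -> : n%:R = 0 :> R by rewrite n0.
  by rewrite invr0 scale0r scaler0.
have {n1 n_gt0}n_gt1 : (1 < n)%N by rewrite ltn_neqAle eq_sym n1.
(* sigma(u, v) is normal, hence of the form J dF w; its square norm vanishes. *)
have [sN _] := normal_part_spec (nabla_dmap f p c d u v) f_immersion apcd.
have := sN; rewrite -(f_lagrangian p c d apcd) => -[_ [w _ <-] sJ].
apply/eqP/negPn/negP => /(metric_posdef apcd).
rewrite [X in ambient_metric _ _ _ _ X]/sff -sJ f_umbilical//.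
rewrite /ambient_metric bformZl -/(ambient_metric f p d _ _).
by rewrite umbilical_curvature_orthogonal// mulr0 ltxx.
Qed.
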